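(* Let $k$ be a field, $S$ an idempotent semiring, and $\nu:k\to S$ a semivaluation. Given an integral $k$-algebra $A$ (i.e. a $k$-algebra that is an integral domain), the $S$-scheme $\mathrm{Trop}_{univ}(\mathrm{Spec}\,A)$ represents the functor on affine $S$-schemes sending $\mathrm{Spec}\,T$ (for $T$ an $S$-algebra) to the set of semivaluations $A\to T$ compatible with $\nu$. In particular, there is a universal semivaluation on $A$ compatible with $\nu$, and it takes values in the semiring of regular functions on the universal tropicalization $\mathrm{Trop}_{univ}(\mathrm{Spec}\,A)$.
   Context: All monoids, rings and semirings are commutative with multiplicative unit; semirings have an additive unit. Semivaluations. For a ring $R$ and an idempotent semiring $S$, a semivaluation $\nu:R\to S$ is a map with $\nu(0)=0_S$, $\nu(1)=\nu(-1)=1_S$, $\nu(ab)=\nu(a)\nu(b)$ and $\nu(a+b)+\nu(a)+\nu(b)=\nu(a)+\nu(b)$. If $A$ is an $R$-algebra and $T$ an $S$-algebra, a semivaluation $w:A\to T$ is compatible with $\nu$ if the composite $R\to A\xrightarrow{w}T$ equals the composite $R\xrightarrow{\nu}S\to T$. A semivaluation $w:A\to S'$ with $S'$ an $S$-algebra, compatible with $\nu$, is universal if for every semivaluation $w':A\to T$ compatible with $\nu$ there is a unique $S$-algebra homomorphism $f:S'\to T$ with $w'=f\circ w$. Universal tropicalization. An $\mathbb{F}_1$-algebra is a commutative monoid-with-zero $B$; for a (semi)ring $R$, $B\otimes_{\mathbb{F}_1}R$ is the $R$-algebra generated by symbols $x_b$ ($b\in B$) with $x_ax_b=x_{ab}$,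 $x_1=1$, $x_0=0$ (free as an $R$-module on $\{x_b:b\ne0\}$). $M(A)$ is the underlying multiplicative monoid-with-zero of $A$. Let $ev:M(A)\otimes_{\mathbb{F}_1}k\to A$ be the $k$-algebra map $x_a\mapsto a$. Let $\mathrm{trop}(\ker ev)\subset M(A)\otimes_{\mathbb{F}_1}S$ be the ideal generated by the elements $\nu(f)=\sum\nu(\lambda_i)x_{a_i}$ for $f=\sum\lambda_ix_{a_i}\in\ker ev$ (distinct $a_i\neq0$), and let $\mathcal{B}\,\mathrm{trop}(\ker ev)$ be the semiring congruence generated by the bend relations $g\sim g_{\widehat{a}}$ for $g\in\mathrm{trop}(\ker ev)$ and $a$ a monomial term of $g$, where $g_{\widehat{a}}$ is $g$ with that term deleted. Then $$\mathrm{Trop}_{univ}(\mathrm{Spec}\,A)=\mathrm{Spec}\bigl(M(A)\otimes_{\mathbb{F}_1}S/\mathcal{B}\,\mathrm{trop}(\ker ev)\bigr).$$ Affine $S$-schemes form the opposite category of $S$-algebras. *)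

(* Defs.v *)
From HB Require Import structures.
From mathcomp Require Import all_boot all_order all_algebra finmap.
From mathcomp Require Import boolp.

Set Implicit Arguments.
Unset Strict Implicit.
Unset Printing Implicit Defensive.

Import GRing.Theory.
Local Open Scope fset_scope.
Local Open Scope ring_scope.

(* The algebra structures of ssralg exclude the zero semiring, which has to   *)
(* be allowed here, so an R-algebra is a commutative semiring together with a *)
(* morphism from R.                                                           *)
Record algebra (R : comPzSemiRingType) := Algebra {
  alg_sort :> comPzSemiRingType;
  structure_map : {rmorphism R -> alg_sort}
}.

Record algHom (R : comPzSemiRingType) (T U : algebra R) := AlgHom {
  alg_fun :> {rmorphism T -> U};
  alg_funP : forall r, alg_fun (structure_map T r) = structure_map U r
}.

Section AlgHomCategory.
Variables (R : comPzSemiRingType) (T U V : algebra R).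

Definition algId : algHom T T := @AlgHom R T T idfun (fun=> erefl).

Lemma algComp_subproof (g : algHom U V) (f : algHom T U) r :
  (g \o f) (structure_map T r) = structure_map V r.
Proof. by rewrite /= !alg_funP. Qed.

Definition algComp (g : algHom U V) (f : algHom T U) : algHom T V :=
  @AlgHom R T V (alg_fun g \o alg_fun f) (algComp_subproof g f).

End AlgHomCategory.

(* Affine S-schemes form the opposite category of S-algebras.                 *)

Record affScheme (S : comPzSemiRingType) := Spec { regular : algebra S }.

Definition affHom S (X Y : affScheme S) := algHom (regular Y) (regular X).

Definition affId S (X : affScheme S) : affHom X X := algId (regular X).

Definition affComp S (X Y Z : affScheme S) (g : affHom Y Z) (f : affHom X Y) :
  affHom X Z := algComp f g.

Record affFunctor (S : comPzSemiRingType) := AffFunctor {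
  points :> affScheme S -> Type;
  pullback : forall X Y, affHom X Y -> points Y -> points X;
  pullback_id : forall X (x : points X), pullback (affId X) x = x;
  pullback_comp : forall X Y Z (g : affHom Y Z) (f : affHom X Y) (z : points Z),
    pullback (affComp g f) z = pullback f (pullback g z)
}.

Definition represents S (X : affScheme S) (F : affFunctor S) : Prop :=
  exists phi : forall Y, affHom Y X -> F Y,
    (forall Y, bijective (@phi Y)) /\
    (forall Y Z (h : affHom Z Y) (f : affHom Y X),
       phi Z (affComp f h) = pullback h (phi Y f)).

Definition semivaluation (R : comPzRingType) (S : comPzSemiRingType)
    (v : R -> S) : Prop :=
  [/\ v 0 = 0, v 1 = 1 /\ v (-1) = 1,
      forall a b, v (a * b) = v a * v b
    & forall a b, v (a + b) + v a + v b = v a + v b].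

Section CompatibleSemivaluations.
Variables (k : fieldType) (S : comPzSemiRingType) (nu : k -> S).
Variable A : comAlgType k.

Definition compatible (T : algebra S) (w : A -> T) : Prop :=
  forall c : k, w c%:A = structure_map T (nu c).

Definition universal (T : algebra S) (w : A -> T) : Prop :=
  [/\ semivaluation w, compatible w
    & forall (U : algebra S) (w' : A -> U), semivaluation w' -> compatible w' ->
        exists! f : algHom T U, w' =1 f \o w].

Definition semivaluations (X : affScheme S) : Type :=
  {w : A -> regular X | semivaluation w /\ compatible w}.

Lemma pullback_subproof (X Y : affScheme S) (f : affHom X Y)
    (w : semivaluations Y) :
  semivaluation (f \o sval w) /\ compatible (f \o sval w).
Proof.
case: w => w [[w0 [w1 wN1] wM wD] wc] /=; split; last first.
  by move=> c /=; rewrite wc alg_funP.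
split=> [||a b|a b] /=.
- by rewrite w0 rmorph0.
- by rewrite w1 wN1 rmorph1.
- by rewrite wM rmorphM.
- by rewrite -!rmorphD wD.
Qed.

Definition semivaluations_pullback (X Y : affScheme S) (f : affHom X Y)
    (w : semivaluations Y) : semivaluations X :=
  exist _ (f \o sval w) (pullback_subproof f w).

Lemma semivaluations_pullback_id X (w : semivaluations X) :
  semivaluations_pullback (affId X) w = w.
Proof. by case: w => w hw; apply: eq_exist. Qed.

Lemma semivaluations_pullback_comp X Y Z (g : affHom Y Z) (f : affHom X Y)
    (w : semivaluations Z) :
  semivaluations_pullback (affComp g f) w =
  semivaluations_pullback f (semivaluations_pullback g w).
Proof. by apply: eq_exist. Qed.

Definition Semivaluations : affFunctor S :=
  AffFunctor semivaluations_pullback_id semivaluations_pullback_comp.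

End CompatibleSemivaluations.

Section Quotients.
Variable Q : comPzSemiRingType.

Definition is_ideal (I : Q -> Prop) : Prop :=
  [/\ I 0, forall x y, I x -> I y -> I (x + y)
    & forall q x, I x -> I (q * x)].

Definition ideal_generated (G : Q -> Prop) (x : Q) : Prop :=
  forall I, is_ideal I -> (forall y, G y -> I y) -> I x.

Definition is_congruence (E : Q -> Q -> Prop) : Prop :=
  [/\ forall x, E x x,
      forall x y, E x y -> E y x,
      forall x y z, E x y -> E y z -> E x z,
      forall x x' y y', E x x' -> E y y' -> E (x + y) (x' + y')
    & forall x x' y y', E x x' -> E y y' -> E (x * y) (x' * y')].

Definition congruence_generated (G : Q -> Q -> Prop) (x y : Q) : Prop :=
  forall E, is_congruence E -> (forall u v, G u v -> E u v) -> E x y.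

Lemma congruence_generatedP G : is_congruence (congruence_generated G).
Proof.
split.
- by move=> x E [].
- by move=> x y xy E EC EG; case: (EC) => _ + _ _ _; apply; exact: xy.
- move=> x y z xy yz E EC EG; case: (EC) => _ _ + _ _.
  by apply; [exact: xy | exact: yz].
- move=> x x' y y' xx yy E EC EG; case: (EC) => _ _ _ + _.
  by apply; [exact: xx | exact: yy].
- move=> x x' y y' xx yy E EC EG; case: (EC) => _ _ _ _.
  by apply; [exact: xx | exact: yy].
Qed.

Variable G : Q -> Q -> Prop.

Definition congr_rel : rel Q := fun x y => `[< congruence_generated G x y >].

Lemma congr_rel_equiv : equiv_class_of congr_rel.
Proof.
have [Er Es Et _ _] := congruence_generatedP G.
split=> [x|x y|y x z]; first exact/asboolP.
  by apply/asboolP/asboolP; exact: Es.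
by move=> /asboolP xy /asboolP yz; apply/asboolP; exact: Et yz.
Qed.

Canonical congr_equiv := EquivRelPack congr_rel_equiv.

Definition quotient := {eq_quot congr_equiv}%qT.

HB.instance Definition _ := Choice.on quotient.
HB.instance Definition _ := EqQuotient.on quotient.

Local Notation pi := (\pi_quotient%qT).

Lemma quotientP x y : pi x = pi y <-> congruence_generated G x y.
Proof. by split=> [/eqmodP/asboolP | xy]; last exact/eqmodP/asboolP. Qed.

Lemma quotient_ind (P : quotient -> Prop) :
  (forall x, P (pi x)) -> forall q, P q.
Proof. by move=> Ppi q; rewrite -[q]reprK. Qed.

Definition quotient_zero : quotient := pi 0.
Definition quotient_one : quotient := pi 1.
Definition quotient_add (x y : quotient) : quotient :=
  pi (repr x + repr y).
Definition quotient_mul (x y : quotient) : quotient :=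
  pi (repr x * repr y).

Lemma pi_repr x : congruence_generated G (repr (pi x)) x.
Proof. by apply/quotientP; rewrite reprK. Qed.

Lemma pi_add x y : quotient_add (pi x) (pi y) = pi (x + y).
Proof.
have [_ _ _ ED _] := congruence_generatedP G.
by apply/quotientP; apply: ED; exact: pi_repr.
Qed.

Lemma pi_mul x y : quotient_mul (pi x) (pi y) = pi (x * y).
Proof.
have [_ _ _ _ EM] := congruence_generatedP G.
by apply/quotientP; apply: EM; exact: pi_repr.
Qed.

Lemma quotient_addA : associative quotient_add.
Proof.
elim/quotient_ind=> x; elim/quotient_ind=> y; elim/quotient_ind=> z.
by rewrite !pi_add addrA.
Qed.
Lemma quotient_addC : commutative quotient_add.
Proof. by elim/quotient_ind=> x; elim/quotient_ind=> y; rewrite !pi_add addrC. Qed.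
Lemma quotient_add0 : left_id quotient_zero quotient_add.
Proof. by elim/quotient_ind=> x; rewrite pi_add add0r. Qed.

HB.instance Definition _ :=
  GRing.isNmodule.Build quotient quotient_addA quotient_addC quotient_add0.

Lemma quotient_mulA : associative quotient_mul.
Proof.
elim/quotient_ind=> x; elim/quotient_ind=> y; elim/quotient_ind=> z.
by rewrite !pi_mul mulrA.
Qed.
Lemma quotient_mulC : commutative quotient_mul.
Proof. by elim/quotient_ind=> x; elim/quotient_ind=> y; rewrite !pi_mul mulrC. Qed.
Lemma quotient_mul1 : left_id quotient_one quotient_mul.
Proof. by elim/quotient_ind=> x; rewrite pi_mul mul1r. Qed.
Lemma quotient_mulDl : left_distributive quotient_mul +%R.
Proof.
elim/quotient_ind=> x; elim/quotient_ind=> y; elim/quotient_ind=> z.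
have addE a b : pi a + pi b = pi (a + b) :> quotient by exact: pi_add.
by rewrite addE !pi_mul addE mulrDl.
Qed.
Lemma quotient_mul0 : left_zero 0 quotient_mul.
Proof. by elim/quotient_ind=> x; rewrite pi_mul mul0r. Qed.

HB.instance Definition _ := GRing.Nmodule_isComPzSemiRing.Build quotient
  quotient_mulA quotient_mulC quotient_mul1 quotient_mulDl quotient_mul0.

Definition quotient_map (x : Q) : quotient := pi x.

Lemma quotient_map_additive : nmod_morphism quotient_map.
Proof. by split=> // x y; rewrite /quotient_map -pi_add. Qed.
Lemma quotient_map_multiplicative : GRing.monoid_morphism quotient_map.
Proof. by split=> // x y; rewrite /quotient_map -pi_mul. Qed.

HB.instance Definition _ :=
  GRing.isNmodMorphism.Build Q quotient quotient_map quotient_map_additive.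
HB.instance Definition _ :=
  GRing.isMonoidMorphism.Build Q quotient quotient_map
    quotient_map_multiplicative.

End Quotients.

Definition quotient_algebra (S : comPzSemiRingType) (T : algebra S)
    (G : T -> T -> Prop) : algebra S :=
  Algebra (@quotient_map T G \o structure_map T).

HB.mixin Record Monoid_isF1Algebra B of monoid.Monoid B := {
  f1zero : B;
  f1mulC : commutative (@monoid.mul B);
  f1mul0 : left_zero f1zero (@monoid.mul B)
}.

#[short(type="f1algType")]
HB.structure Definition F1Algebra :=
  { B of Monoid_isF1Algebra B & monoid.Monoid B }.

Section MultiplicativeMonoid.
Variable A : comPzSemiRingType.

Definition mulmonoid : Type := A.

HB.instance Definition _ := Choice.on mulmonoid.
HB.instance Definition _ := monoid.isMonoid.Build mulmonoid
  (@mulrA A) (@mul1r A) (@mulr1 A).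
HB.instance Definition _ := Monoid_isF1Algebra.Build mulmonoid
  (@mulrC A) (@mul0r A).

End MultiplicativeMonoid.

(* B tensored with R over F_1: f stands for the formal sum of the f a * x_a   *)
(* over the nonzero a in B, so its support consists of distinct nonzero a.    *)
Definition tensor (B : f1algType) (R : comPzSemiRingType) : Type :=
  {fsfun {b : B | b != f1zero} -> R with 0}.

Section Tensor.
Variables (B : f1algType) (R : comPzSemiRingType).
Local Notation B0 := {b : B | b != f1zero}.
Local Notation BR := (tensor B R).

HB.instance Definition _ := Choice.on BR.

Definition tensor_zero : BR := [fsfun].
Definition tensor_add (f g : BR) : BR :=
  [fsfun a in finsupp f `|` finsupp g => f a + g a].

Lemma tensor_addE f g a : tensor_add f g a = f a + g a.
Proof.
rewrite fsfunE in_fsetU.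
by case: (finsuppP f a); case: (finsuppP g a); rewrite /= ?addr0.
Qed.

Lemma tensor_addA : associative tensor_add.
Proof. by move=> f g h; apply/fsfunP=> a; rewrite !tensor_addE addrA. Qed.
Lemma tensor_addC : commutative tensor_add.
Proof. by move=> f g; apply/fsfunP=> a; rewrite !tensor_addE addrC. Qed.
Lemma tensor_add0 : left_id tensor_zero tensor_add.
Proof. by move=> f; apply/fsfunP=> a; rewrite tensor_addE [X in X + _]fsfun0E add0r. Qed.

HB.instance Definition _ :=
  GRing.isNmodule.Build BR tensor_addA tensor_addC tensor_add0.

(* r * x_b, where x_0 = 0 *)
Definition monomial (b : B) (r : R) : BR :=
  if insub b is Some a then [fsfun x in [fset a] => r] else 0.

Definition tensor_one : BR := monomial 1%g 1.
Definition tensor_mul (f g : BR) : BR :=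
  \sum_(a <- finsupp f) \sum_(b <- finsupp g)
     monomial (val a * val b)%g (f a * g b).

Lemma coefD (f g : BR) a : (f + g) a = f a + g a.
Proof. exact: tensor_addE. Qed.

Lemma coef0 a : (0 : BR) a = 0.
Proof. exact: fsfun0E. Qed.

Lemma coef_monomial b r (a : B0) :
  monomial b r a = if val a == b then r else 0.
Proof.
rewrite /monomial; case: insubP => [c _ <-|b0].
  by rewrite fsfunE in_fset1 val_eqE.
by rewrite coef0; case: eqP => // ab; move: b0; rewrite -ab (valP a).
Qed.

Lemma monomial0 b : monomial b 0 = 0.
Proof. by apply/fsfunP=> a; rewrite coef_monomial coef0 if_same. Qed.

Lemma monomialD b r s : monomial b (r + s) = monomial b r + monomial b s.
Proof.
apply/fsfunP=> a; rewrite coefD !coef_monomial.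
by case: eqP => // _; rewrite addr0.
Qed.

Lemma monomial_f1zero r : monomial f1zero r = 0.
Proof. by rewrite /monomial insubF ?eqxx. Qed.

Section Extension.
Variables (V : nmodType) (F : B0 -> R -> V).
Hypotheses (F0 : forall a, F a 0 = 0)
  (FD : forall a r s, F a (r + s) = F a r + F a s).
Definition tensor_ext (f : BR) : V := \sum_(a <- finsupp f) F a (f a).

Lemma tensor_extE (D : {fset B0}) (f : BR) : finsupp f `<=` D ->
  tensor_ext f = \sum_(a <- D) F a (f a).
Proof. by move=> fD; apply: big_fset_incl => // a _ /fsfun_dflt ->. Qed.

Lemma tensor_ext0 : tensor_ext 0 = 0.
Proof. by rewrite /tensor_ext big1 // => a _; rewrite coef0. Qed.

Lemma tensor_extD f g : tensor_ext (f + g) = tensor_ext f + tensor_ext g.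
Proof.
have fgD : finsupp (f + g : BR) `<=` finsupp f `|` finsupp g.
  exact: finsupp_sub.
rewrite (tensor_extE fgD) (tensor_extE (fsubsetUl _ (finsupp g))).
rewrite (tensor_extE (fsubsetUr (finsupp f) _)) -big_split /=.
by apply: eq_bigr => a _; rewrite coefD FD.
Qed.

Lemma tensor_ext_monomial (a : B0) r :
  tensor_ext (monomial (val a) r) = F a r.
Proof.
have sD : finsupp (monomial (val a) r) `<=` [fset a].
  apply/fsubsetP=> c; rewrite mem_finsupp coef_monomial in_fset1 val_eqE.
  by case: (c == a); rewrite ?eqxx.
by rewrite (tensor_extE sD) big_seq_fset1 coef_monomial eqxx.
Qed.
End Extension.

Lemma tensor_decomp (f : BR) :
  f = \sum_(a <- finsupp f) monomial (val a) (f a).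
Proof.
have coefS (I : Type) (s : seq I) (G : I -> BR) c :
    (\sum_(i <- s) G i) c = \sum_(i <- s) (G i) c.
  by elim/big_rec2: _ => [|i x y _ <-]; rewrite ?coef0 // coefD.
apply/fsfunP=> c; rewrite coefS.
under eq_bigr => a _ do rewrite coef_monomial val_eqE.
case: finsuppP => [cf|cf].
  rewrite big_seq big1 // => a af; case: eqP => // ca.
  by rewrite -ca (negPf cf) in af.
rewrite (big_fsetD1 c) //= eqxx big_seq big1 ?addr0 // => a.
by rewrite in_fsetD1 eq_sym => /andP[/negPf->].
Qed.

Lemma tensor_ind (P : BR -> Prop) :
  P 0 -> (forall f g, P f -> P g -> P (f + g)) ->
  (forall a r, P (monomial a r)) -> forall f, P f.
Proof.
move=> P0 PD Pm f; rewrite (tensor_decomp f).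
by elim/big_ind: _ => //.
Qed.

Lemma tensor_mul0l : left_zero 0 tensor_mul.
Proof.
by move=> g; rewrite /tensor_mul big1 // => a _; rewrite coef0 big1 // => b _;
  rewrite mul0r monomial0.
Qed.

Lemma tensor_mulDl : left_distributive tensor_mul +%R.
Proof.
move=> f g h.
pose F (a : B0) r :=
  \sum_(b <- finsupp h) monomial (val a * val b)%g (r * h b) : BR.
apply: (@tensor_extD _ F) => [a|a r s].
  by rewrite /F big1 // => b _; rewrite mul0r monomial0.
by rewrite /F -big_split; apply: eq_bigr => b _; rewrite mulrDl monomialD.
Qed.

Lemma tensor_mulC : commutative tensor_mul.
Proof.
move=> f g; rewrite /tensor_mul exchange_big /=; apply: eq_bigr => b _.
by apply: eq_bigr => a _; rewrite f1mulC mulrC.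
Qed.

Lemma tensor_mulDr : right_distributive tensor_mul +%R.
Proof. by move=> f g h; rewrite !(tensor_mulC f) tensor_mulDl. Qed.

Lemma tensor_mul0r : right_zero 0 tensor_mul.
Proof. by move=> f; rewrite tensor_mulC tensor_mul0l. Qed.

Lemma monomialM a b r s :
  tensor_mul (monomial a r) (monomial b s) = monomial (a * b)%g (r * s).
Proof.
have [->|a0] := eqVneq a f1zero.
  by rewrite f1mul0 !monomial_f1zero tensor_mul0l.
have [->|b0] := eqVneq b f1zero.
  by rewrite f1mulC f1mul0 !monomial_f1zero tensor_mul0r.
pose a' : B0 := Sub a a0; pose b' : B0 := Sub b b0.
pose F (c : B0) t :=
  \sum_(d <- finsupp (monomial b s))
     monomial (val c * val d)%g (t * monomial b s d) : BR.
have F0 c : F c 0 = 0 by rewrite /F big1 // => d _; rewrite mul0r monomial0.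
rewrite -[LHS]/(tensor_ext F (monomial (val a') r)) tensor_ext_monomial //.
pose G (d : B0) t := monomial (a * val d)%g (r * t).
have G0 d : G d 0 = 0 by rewrite /G mulr0 monomial0.
by rewrite -[LHS]/(tensor_ext G (monomial (val b') s)) tensor_ext_monomial.
Qed.

Lemma tensor_mulA : associative tensor_mul.
Proof.
move=> f g h; elim/tensor_ind: f => [|f f' IH IH'|a r].
- by rewrite !tensor_mul0l.
- by rewrite !tensor_mulDl IH IH'.
elim/tensor_ind: g => [|g g' IH IH'|b s].
- by rewrite !(tensor_mul0l, tensor_mul0r).
- by rewrite !(tensor_mulDl, tensor_mulDr) IH IH'.
elim/tensor_ind: h => [|h h' IH IH'|c t].
- by rewrite !tensor_mul0r.
- by rewrite !tensor_mulDr IH IH'.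
by rewrite !monomialM mulgA mulrA.
Qed.

Lemma tensor_mul1 : left_id tensor_one tensor_mul.
Proof.
elim/tensor_ind => [|f g IHf IHg|a r]; first by rewrite tensor_mul0r.
  by rewrite tensor_mulDr IHf IHg.
by rewrite monomialM mul1g mul1r.
Qed.

HB.instance Definition _ := GRing.Nmodule_isComPzSemiRing.Build BR
  tensor_mulA tensor_mulC tensor_mul1 tensor_mulDl tensor_mul0l.

Definition tensor_const (r : R) : BR := monomial 1%g r.

Lemma tensor_const_additive : nmod_morphism tensor_const.
Proof. by split=> [|r s]; [exact: monomial0 | exact: monomialD]. Qed.
Lemma tensor_const_multiplicative : GRing.monoid_morphism tensor_const.
Proof.
by split=> // r s; rewrite [RHS]monomialM mulg1.
Qed.

HB.instance Definition _ :=
  GRing.isNmodMorphism.Build R BR tensor_const tensor_const_additive.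
HB.instance Definition _ :=
  GRing.isMonoidMorphism.Build R BR tensor_const tensor_const_multiplicative.

Definition tensor_algebra : algebra R := @Algebra R BR tensor_const.

End Tensor.

Section UniversalTropicalization.
Variables (k : fieldType) (S : comPzSemiRingType) (nu : k -> S).
Variable A : comAlgType k.
Local Notation MA := (mulmonoid A).

Definition ev (f : tensor MA k) : A :=
  \sum_(a <- finsupp f) f a *: (val a : A).

Definition trop_elt (f : tensor MA k) : tensor MA S :=
  [fsfun a in finsupp f => nu (f a)].

Definition trop_ker : tensor MA S -> Prop :=
  ideal_generated (fun g => exists2 f, ev f = 0 & g = trop_elt f).

Definition bend (g h : tensor MA S) : Prop :=
  trop_ker g /\ exists2 a, a \in finsupp g & h = [fsfun g without a].

Definition Trop_univ : affScheme S :=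
  Spec (@quotient_algebra S (tensor_algebra MA S) bend).

End UniversalTropicalization.

(* Main.v *)
(** Write x_a for the class of the symbol of a.  The bend relations of the
    elements x_{a+b} - x_a - x_b and x_{c1} - c x_1 of ker ev say that a |-> x_a
    is a compatible semivaluation.  Conversely, a compatible semivaluation w
    extends to x_a |-> w a on the tensor product, and this extension respects the
    bend relations of trop f for f in ker ev, because each term of a vanishing
    sum is minus the sum of the others.  Since A is integral, multiplication by
    a nonzero monomial is injective on monomials, so that the bend relations pass
    from the generators of the ideal to the whole ideal. *)
From HB Require Import structures.
From mathcomp Require Import all_boot all_algebra finmap.
From mathcomp Require Import boolp.
Require Import Defs.

Set Implicit Arguments.
Unset Strict Implicit.
Unset Printing Implicit Defensive.

Import GRing.Theory.
Local Open Scope fset_scope.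
Local Open Scope ring_scope.

(** Uniqueness in [universal] is Leibniz equality of records, hence the recourse to function
    extensionality and proof irrelevance. *)
Lemma algHom_eq (R : comPzSemiRingType) (T U : algebra R) (f g : algHom T U) :
  f =1 g -> f = g.
Proof.
case: f => [[f [[f1] [f2]]] fP]; case: g => [[g [[g1] [g2]]] gP] /= /funext fg.
rewrite /= in f1 f2 fP g1 g2 gP fg *; subst g.
by rewrite (Prop_irrelevance f1 g1) (Prop_irrelevance f2 g2) in fP *;
  rewrite (Prop_irrelevance fP gP).
Qed.

(** * Homomorphisms out of a quotient by a generated congruence *)

Section QuotientLift.
Variables (S : comPzSemiRingType) (T U : algebra S) (G : T -> T -> Prop).
Variable f : algHom T U.
Hypothesis fG : forall x y, G x y -> f x = f y.

Definition quotient_lift (q : quotient G) : U := f (repr q).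

(** The relation f y = f z is a congruence containing [G], so it contains the generated one; hence
    the choice made by [repr] is immaterial. *)
Lemma quotient_liftE x : quotient_lift (quotient_map G x) = f x.
Proof.
have /(_ (fun y z => f y = f z)) := pi_repr (G := G) x.
apply; last exact: fG.
split=> //.
- by move=> y z t -> ->.
- by move=> y y' z z' yy zz; rewrite !rmorphD yy zz.
- by move=> y y' z z' yy zz; rewrite !rmorphM yy zz.
Qed.

Lemma quotient_lift_additive : nmod_morphism quotient_lift.
Proof.
split=> [|x y]; first by rewrite -(rmorph0 (quotient_map G)) quotient_liftE rmorph0.
elim/quotient_ind: x => x; elim/quotient_ind: y => y.
rewrite -!/(quotient_map G _) -rmorphD !quotient_liftE.
exact: rmorphD.
Qed.

Lemma quotient_lift_multiplicative : GRing.monoid_morphism quotient_lift.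
Proof.
split=> [|x y]; first by rewrite -(rmorph1 (quotient_map G)) quotient_liftE rmorph1.
elim/quotient_ind: x => x; elim/quotient_ind: y => y.
rewrite -!/(quotient_map G _) -rmorphM !quotient_liftE.
exact: rmorphM.
Qed.

HB.instance Definition _ :=
  GRing.isNmodMorphism.Build (quotient G) U quotient_lift quotient_lift_additive.
HB.instance Definition _ :=
  GRing.isMonoidMorphism.Build (quotient G) U quotient_lift
    quotient_lift_multiplicative.

Lemma quotient_lift_structure r :
  quotient_lift (structure_map (quotient_algebra G) r) = structure_map U r.
Proof. by rewrite /= quotient_liftE alg_funP. Qed.

Definition quotient_liftHom : algHom (quotient_algebra G) U :=
  @AlgHom S (quotient_algebra G) U quotient_lift quotient_lift_structure.

End QuotientLift.

(** * Homomorphisms out of the tensor product *)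

Section TensorLift.
Variables (B : f1algType) (S : comPzSemiRingType) (U : algebra S) (w : B -> U).
Hypotheses (w0 : w f1zero = 0) (w1 : w 1%g = 1)
  (wM : forall a b, w (a * b)%g = w a * w b).

Let term (a : {b : B | b != f1zero}) (r : S) : U :=
  structure_map U r * w (val a).

Definition tensor_lift : tensor B S -> U := tensor_ext term.

Let term0 a : term a 0 = 0.
Proof. by rewrite /term rmorph0 mul0r. Qed.

Lemma tensor_lift_additive : nmod_morphism tensor_lift.
Proof.
split=> [|f g]; first exact: tensor_ext0.
by apply: tensor_extD => // a r s; rewrite /term rmorphD mulrDl.
Qed.

HB.instance Definition _ :=
  GRing.isNmodMorphism.Build (tensor B S) U tensor_lift tensor_lift_additive.

(** By [w0] this covers b zero too, so multiplicativity can be checked on monomials even where a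
    product of symbols vanishes. *)
Lemma tensor_lift_monomial b r :
  tensor_lift (monomial b r) = structure_map U r * w b.
Proof.
have [->|b0] := eqVneq b f1zero.
  by rewrite monomial_f1zero raddf0 w0 mulr0.
exact: (tensor_ext_monomial term0 (Sub b b0)).
Qed.

Lemma tensor_lift_multiplicative : GRing.monoid_morphism tensor_lift.
Proof.
split=> [|f g].
  by rewrite [1]/(tensor_one _ _) tensor_lift_monomial rmorph1 w1 mulr1.
elim/tensor_ind: f => [|f f' IH IH'|a r].
- by rewrite mul0r raddf0 mul0r.
- by rewrite mulrDl !raddfD /= IH IH' mulrDl.
elim/tensor_ind: g => [|g g' IH IH'|b s].
- by rewrite mulr0 raddf0 mulr0.
- by rewrite mulrDr !raddfD /= IH IH' mulrDr.
by rewrite [_ * _]monomialM !tensor_lift_monomial wM rmorphM mulrACA.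
Qed.

HB.instance Definition _ :=
  GRing.isMonoidMorphism.Build (tensor B S) U tensor_lift
    tensor_lift_multiplicative.

Lemma tensor_lift_structure r :
  tensor_lift (structure_map (tensor_algebra B S) r) = structure_map U r.
Proof. by rewrite /= tensor_lift_monomial w1 mulr1. Qed.

Definition tensor_liftHom : algHom (tensor_algebra B S) U :=
  @AlgHom S (tensor_algebra B S) U tensor_lift tensor_lift_structure.

End TensorLift.

(** * Deletion of terms, and its behaviour under multiplication *)

Section Deletion.
Variables (B : f1algType) (R : comPzSemiRingType).
Implicit Types (f g : tensor B R) (a c : {b : B | b != f1zero}).

Definition delete a f : tensor B R := [fsfun f without a].

Lemma coef_delete a f c : delete a f c = if c == a then 0 else f c.
Proof. by rewrite /delete fsfun_withE. Qed.

Lemma deleteD a f g : delete a (f + g) = delete a f + delete a g.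
Proof.
apply/fsfunP=> c; rewrite coefD !coef_delete coefD.
by case: eqP; rewrite ?addr0.
Qed.

Lemma delete0 a : delete a 0 = 0.
Proof. by apply/fsfunP=> c; rewrite coef_delete coef0 if_same. Qed.

Lemma delete_monomial a b r :
  delete a (monomial b r) = if val a == b then 0 else monomial b r.
Proof.
apply/fsfunP=> c; rewrite coef_delete.
have [->|ca] := eqVneq c a.
  by case: (eqVneq (val a) b) => ab; rewrite ?coef0 // coef_monomial (negPf ab).
case: (eqVneq (val a) b) => // <-.
by rewrite coef0 coef_monomial val_eqE (negPf ca).
Qed.

Hypothesis mulI : forall b a c : B, b != f1zero -> (b * a = b * c)%g -> a = c.

(** By [mulI], the only term of f that multiplication by b sends to c is the one at a. *)
Lemma delete_monomialM b r a c f : (b * val a = val c)%g ->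
  delete c (monomial b r * f) = monomial b r * delete a f.
Proof.
move=> bac.
have b0 : b != f1zero.
  by apply: contraNneq (valP c) => b0; rewrite -bac b0 f1mul0.
elim/tensor_ind: f => [|f g IHf IHg|d s].
- by rewrite delete0 !mulr0 delete0.
- by rewrite deleteD !mulrDr deleteD IHf IHg.
rewrite [monomial b r * _]monomialM !delete_monomial -bac.
have [->|ad] := eqVneq (val a) d; first by rewrite eqxx mulr0.
case: eqP => [/(mulI b0)/eqP|_]; first by rewrite (negPf ad).
by rewrite [RHS]monomialM.
Qed.

Lemma delete_monomialM_id b r c f : ~ (exists a, b * val a = val c)%g ->
  delete c (monomial b r * f) = monomial b r * f.
Proof.
move=> bc; elim/tensor_ind: f => [|f g IHf IHg|d s].
- by rewrite !mulr0 delete0.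
- by rewrite !mulrDr deleteD IHf IHg.
rewrite [monomial b r * _]monomialM delete_monomial.
case: eqP => // cbd; case: bc.
have d0 : d != f1zero.
  by apply: contraNneq (valP c) => d0; rewrite cbd d0 f1mulC f1mul0.
by exists (Sub d d0).
Qed.

(** This lets bend relations be checked on the generators of an ideal. As [delete] is additive, the
    multiplier may be taken to be a monomial; deleting c from the product then amounts to deleting
    one term of x, or none. *)
Lemma bend_invariant_ideal (U : pzSemiRingType)
    (F : {rmorphism tensor B R -> U}) :
  is_ideal (fun g => forall a, F (delete a g) = F g).
Proof.
pose I g := forall a, F (delete a g) = F g.
have ID x y : I x -> I y -> I (x + y).
  by move=> xI yI a; rewrite deleteD !rmorphD xI yI.
have I0 : I 0 by move=> a; rewrite delete0.
split=> // q x xI; rewrite -/(I (q * x)).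
elim/tensor_ind: q => [|f g IHf IHg|b r]; first by rewrite mul0r.
  by rewrite mulrDl; exact: ID.
move=> c; have [[a bac]|bc] := pselect (exists a, b * val a = val c)%g.
  by rewrite (delete_monomialM _ _ bac) !rmorphM xI.
by rewrite delete_monomialM_id.
Qed.

End Deletion.

(** * Semivaluations of negatives and of finite sums *)

Section Semivaluations.
Variables (R : comPzRingType) (U : comPzSemiRingType) (w : R -> U).
Hypothesis sw : semivaluation w.

Lemma semivaluationN a : w (- a) = w a.
Proof. by case: sw => _ [_ wN1] wM _; rewrite -mulN1r wM wN1 mul1r. Qed.

(** The iterated triangle inequality, with x + y = y in the role of x <= y. *)
Lemma semivaluation_sum (I : Type) (s : seq I) (P : pred I) (u : I -> R) :
  w (\sum_(i <- s | P i) u i) + \sum_(i <- s | P i) w (u i) =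
  \sum_(i <- s | P i) w (u i).
Proof.
case: sw => w0 _ _ wD.
elim/big_rec2: _ => [|i y x _ IH]; first by rewrite w0 addr0.
by rewrite -{1}IH !addrA wD -addrA IH.
Qed.

End Semivaluations.

(** * Evaluation, and bend relations under a compatible semivaluation *)

Section Tropicalization.
Variables (k : fieldType) (S : comPzSemiRingType) (nu : k -> S).
Hypothesis nu_semival : semivaluation nu.
Variable A : comAlgType k.
Local Notation MA := (mulmonoid A).

Let ev_term (a : {a : MA | a != f1zero}) (r : k) : A := r *: (val a : A).

Lemma evD (f g : tensor MA k) : ev (f + g) = ev f + ev g.
Proof.
rewrite -[LHS]/(tensor_ext ev_term (f + g)) tensor_extD // => [a|a r s].
  exact: scale0r.
exact: scalerDl.
Qed.

Lemma ev_monomial (a : A) c : ev (monomial (a : MA) c) = c *: a.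
Proof.
have [->|a0] := eqVneq (a : MA) f1zero.
  by rewrite monomial_f1zero scaler0 /ev big1 // => b _; rewrite coef0 scale0r.
pose a' : {a : MA | a != f1zero} := Sub (a : MA) a0.
rewrite -[LHS]/(tensor_ext ev_term (monomial (val a') c)) tensor_ext_monomial //.
by move=> b; exact: scale0r.
Qed.

Lemma coef_trop (f : tensor MA k) a : trop_elt nu f a = nu (f a).
Proof.
rewrite fsfunE; case: finsuppP => //= _.
by case: nu_semival.
Qed.

(** Since ev f = 0, the term at a is minus the sum of the others, so its value is absorbed by the
    sum of their values. *)
Lemma bend_trop_elt (U : algebra S) (w : A -> U) (f : tensor MA k) a :
    semivaluation w -> compatible nu w -> ev f = 0 ->
  tensor_lift (w : MA -> U) (delete a (trop_elt nu f)) =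
  tensor_lift (w : MA -> U) (trop_elt nu f).
Proof.
move=> sw wc; rewrite /ev => f0.
have wterm c (b : A) : structure_map U (nu c) * w b = w (c *: b).
  by case: sw => _ _ wM _; rewrite -mulr_algl wM wc.
have term0 (b : {b : MA | b != f1zero}) :
  structure_map U 0 * w (val b) = 0 by rewrite rmorph0 mul0r.
have sub (g : tensor MA S) :
    (forall c, f c = 0 -> g c = 0) -> finsupp g `<=` finsupp f.
  move=> fg; apply/fsubsetP=> c; rewrite !mem_finsupp.
  by apply: contra_neq => /fg.
have nu0 : nu 0 = 0 by case: nu_semival.
(* Both sums are taken over the support of f, which contains the supports of both elements, and can
   then be compared term by term. *)
rewrite /tensor_lift (tensor_extE term0 (D := finsupp f)); last first.
  by apply: sub => c fc; rewrite coef_delete coef_trop fc nu0 if_same.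
rewrite (tensor_extE term0 (D := finsupp f)); last first.
  by apply: sub => c fc; rewrite coef_trop fc nu0.
under eq_bigr => c _ do rewrite coef_delete coef_trop.
under [RHS]eq_bigr => c _ do rewrite coef_trop wterm.
case: (finsuppP f a) => [af|af].
  rewrite big_seq [RHS]big_seq; apply: eq_bigr => c cf.
  by rewrite (_ : (c == a) = false) ?wterm //; apply: contraNF af => /eqP <-.
rewrite (big_fsetD1 a) //= eqxx term0 add0r [RHS](big_fsetD1 a) //=.
rewrite (big_fsetD1 a) //= in f0.
move/eqP: f0; rewrite addr_eq0 => /eqP ->.
rewrite (semivaluationN sw) semivaluation_sum //.
rewrite big_seq [RHS]big_seq; apply: eq_bigr => c.
by rewrite in_fsetD1 => /andP[/negPf-> _]; rewrite wterm.
Qed.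

(** * The universal semivaluation *)

Local Notation X := (regular (Trop_univ nu A)).

Definition univ_semival (a : A) : X :=
  quotient_map (@bend k S nu A) (monomial (a : MA) 1).

Local Notation q := (quotient_map (@bend k S nu A)).

Lemma q_monomial (a : A) r :
  q (monomial (a : MA) r) = structure_map X r * univ_semival a.
Proof. by rewrite /univ_semival /= -rmorphM [_ * _]monomialM mul1g mulr1. Qed.

(** [bend] asks for a in the support; deleting an absent term changes nothing, so the relation
    extends to every a. *)
Lemma q_bend (f : tensor MA k) a : ev f = 0 ->
  q (delete a (trop_elt nu f)) = q (trop_elt nu f).
Proof.
move=> f0; have [af|af] := finsuppP (trop_elt nu f) a.
  congr q; apply/fsfunP=> c; rewrite coef_delete.
  by case: eqP => // ->; rewrite fsfun_dflt.
apply/esym/quotientP=> E _; apply; split; last by exists a.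
by move=> I _; apply; exists f.
Qed.

(* The bend relation of f - x_a in ker ev, where x_a does not occur in f. *)
Lemma q_trop (f : tensor MA k) (a : {a : MA | a != f1zero}) :
    ev f = val a -> f a = 0 ->
  univ_semival (val a) + q (trop_elt nu f) = q (trop_elt nu f).
Proof.
move=> fa fa0; have [nu0 [_ nuN1] _ _] := nu_semival.
pose h : tensor MA k := monomial (val a) (-1) + f.
have h0 : ev h = 0 by rewrite evD ev_monomial scaleN1r fa addNr.
have hE : trop_elt nu h = monomial (val a) 1 + trop_elt nu f.
  apply/fsfunP=> c; rewrite coefD !coef_trop coefD !coef_monomial val_eqE.
  by case: eqP => [->|_]; rewrite ?fa0 ?nu0 ?addr0 ?add0r.
have := q_bend a h0; rewrite hE deleteD delete_monomial eqxx add0r rmorphD => <-.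
congr q; apply/fsfunP=> c; rewrite coef_delete.
by case: eqP => // ->; rewrite coef_trop fa0 nu0.
Qed.

Lemma trop_monomial b c :
  trop_elt nu (A := A) (monomial b c) = monomial b (nu c).
Proof.
apply/fsfunP=> a; rewrite coef_trop !coef_monomial.
by case: nu_semival => nu0 _ _ _; case: eqP.
Qed.

Hypothesis S_idem : idempotent_op (@GRing.add S).

Lemma regular_idem (x : X) : x + x = x.
Proof.
have -> : x + x = structure_map X (1 + 1) * x.
  by rewrite rmorphD rmorph1 mulrDl mul1r.
by rewrite S_idem rmorph1 mul1r.
Qed.

Lemma univ_semival0 : univ_semival 0 = 0.
Proof. by rewrite /univ_semival monomial_f1zero rmorph0. Qed.

Lemma univ_semival1 : univ_semival 1 = 1.
Proof. exact: rmorph1. Qed.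

Lemma univ_semivalM a b : univ_semival (a * b) = univ_semival a * univ_semival b.
Proof. by rewrite /univ_semival -rmorphM [X in _ = q X]monomialM mulr1. Qed.

Lemma univ_compatible : compatible nu univ_semival.
Proof.
move=> c; have [nu0 [nu1 _] nuM _] := nu_semival.
have [->|c0] := eqVneq c 0.
  by rewrite scale0r nu0 univ_semival0 rmorph0.
(* With x + y = y read as x <= y, this is x_{d1} <= nu d, from the bend relation of d x_1 - x_{d1}.
   For d = 1 the two symbols coincide and idempotence of S is used instead. *)
have le d : d != 0 -> univ_semival d%:A + structure_map X (nu d) =
    structure_map X (nu d).
  move=> d0; have [->|d1] := eqVneq d 1.
    by rewrite scale1r nu1 univ_semival1 rmorph1 -(rmorph1 (structure_map X))
      -rmorphD S_idem.
  have dA0 : (d%:A : A) != 0 by rewrite scaler_eq0 negb_or d0 oner_eq0.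
  pose a : {a : MA | a != f1zero} := Sub (d%:A : MA) dA0.
  have := @q_trop (monomial (1%g : MA) d) a.
  rewrite trop_monomial; apply; first by rewrite ev_monomial.
  (* The symbol of d1 does not occur in d x_1: d1 = 1 would force d = 1, as A is nonzero. *)
  rewrite coef_monomial /=; case: eqP => // dA1.
  have /eqP : (d - 1)%:A = 0 :> A by rewrite scalerBl dA1 scale1r subrr.
  by rewrite scaler_eq0 oner_eq0 orbF subr_eq0 (negPf d1).
(* Multiplying the inequality for c^-1 by x_c nu(c) gives the reverse one for c. *)
have := congr1 (fun t => univ_semival c%:A * structure_map X (nu c) * t)
  (le c^-1 (invr_neq0 c0)).
have wcV : univ_semival c%:A * univ_semival c^-1%:A = 1.
  by rewrite -univ_semivalM mulr_algl scalerA divff // scale1r univ_semival1.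
have nucV : structure_map X (nu c) * structure_map X (nu c^-1) = 1.
  by rewrite -rmorphM -nuM divff // nu1 rmorph1.
rewrite mulrDr mulrAC wcV mul1r -mulrA nucV mulr1 => ge.
by rewrite -ge addrC le.
Qed.

(** The bend relation of x_{a+b} - x_a - x_b settles the case of distinct a and b with a, b, a + b
    nonzero; the degenerate cases come first. *)
Lemma univ_semivalD a b :
  univ_semival (a + b) + univ_semival a + univ_semival b =
  univ_semival a + univ_semival b.
Proof.
have [_ [nu1 _] _ nuD] := nu_semival.
have [->|a0] := eqVneq a 0.
  by rewrite add0r univ_semival0 addr0 add0r regular_idem.
have [->|b0] := eqVneq b 0.
  by rewrite !addr0 univ_semival0 !addr0 regular_idem.
have [ab0|ab0] := eqVneq (a + b) 0; first by rewrite ab0 univ_semival0 add0r.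
(* For a = b the two symbols merge. Writing a + a as (1 + 1) a and using compatibility reduces the
   claim to the inequality for nu at 1 + 1. *)
have [<-|ab] := eqVneq a b.
  have -> : a + a = (1 + 1)%:A * a by rewrite scalerDl scale1r mulrDl mul1r.
  rewrite univ_semivalM univ_compatible -[X in _ + X + X = X + X]mul1r.
  by rewrite -(rmorph1 (structure_map X)) -!mulrDl -!rmorphD -nu1 nuD.
pose ab' : {a : MA | a != f1zero} := Sub (a + b : MA) ab0.
have := @q_trop (monomial (a : MA) 1 + monomial (b : MA) 1) ab'.
(* As a and b differ, no coefficient is 1 + 1: all are 0 or 1, and nu preserves these. *)
have -> : trop_elt nu (monomial (a : MA) 1 + monomial (b : MA) 1) =
    monomial (a : MA) 1 + monomial (b : MA) 1.
  apply/fsfunP=> c; have [nu0 _ _ _] := nu_semival.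
  rewrite coef_trop !coefD !coef_monomial.
  case: (eqVneq (val c) (a : MA)) => [->|_]; first by rewrite (negPf ab) !addr0.
  by rewrite !add0r; case: eqP.
rewrite rmorphD addrA; apply; first by rewrite evD !ev_monomial !scale1r.
(* The sum a + b differs from a and from b because both are nonzero. *)
rewrite coefD !coef_monomial /= ifN ?ifN ?addr0 //.
  by rewrite -subr_eq0 addrK.
by rewrite -subr_eq0 addrC addKr.
Qed.

Lemma univ_semivaluation : semivaluation univ_semival.
Proof.
split; [exact: univ_semival0 | | exact: univ_semivalM | exact: univ_semivalD].
split; first exact: univ_semival1.
rewrite -scaleN1r univ_compatible.
by case: nu_semival => _ [_ ->] _ _; rewrite rmorph1.
Qed.

(** * Universality and representability *)

Hypothesis A_integral : GRing.integral_domain_axiom A.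

Lemma univ_semival_universal : universal nu univ_semival.
Proof.
split; [exact: univ_semivaluation | exact: univ_compatible | move=> U w sw wc].
have [w0 [w1 _] wM _] := sw.
pose F := tensor_liftHom (B := MA) (w := w) w0 w1 wM.
have FG x y : @bend k S nu A x y -> F x = F y.
  case=> xI [a _ ->]; apply/esym.
  (* [xI] puts x in every ideal containing the tropicalizations of ker ev; the ideal taken is that
     of the elements whose image under [F] no deletion changes. Integrality of A supplies the
     cancellation that makes it an ideal. *)
  apply: (xI (fun g => forall a, F (delete a g) = F g)).
    apply: bend_invariant_ideal => b c d b0 /eqP.
    rewrite -subr_eq0 => /eqP; rewrite -[X in X = _]mulrBr => /A_integral.
    by rewrite (negPf b0) subr_eq0 => /eqP.
  by move=> _ [f f0 ->] c; exact: bend_trop_elt.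
pose Fq := quotient_liftHom (T := tensor_algebra MA S) (G := @bend k S nu A) FG.
exists Fq; split=> [a|f fw].
  rewrite /= quotient_liftE //= tensor_lift_monomial //.
  by rewrite rmorph1 mul1r.
(* Uniqueness: every class is a sum of classes of monomials r x_a, where [f] is forced by
   S-linearity and [fw]. *)
apply: algHom_eq; elim/quotient_ind=> x.
rewrite -/(quotient_map _ _) [LHS]quotient_liftE //.
elim/tensor_ind: x => [|x y IHx IHy|a r]; first by rewrite !rmorph0.
  by rewrite !rmorphD IHx IHy.
by rewrite q_monomial rmorphM alg_funP [LHS]tensor_lift_monomial // fw.
Qed.

(** The Yoneda argument: f is sent to the pullback of w along f, and bijectivity at Z is
    universality tested on Z. *)
Lemma universal_represents (Y : affScheme S) (w : A -> regular Y) :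
  universal nu w -> represents Y (Semivaluations nu A).
Proof.
case=> sw wc wU; pose p : Semivaluations nu A Y := exist _ w (conj sw wc).
exists (fun Z f => pullback f p); split=> [Z|Z Z' h f]; last exact: pullback_comp.
(* The choice made by [cid] turns unique existence into an inverse function. *)
have ex (v : Semivaluations nu A Z) :
    {f : affHom Z Y | sval v =1 f \o w /\
       forall g : affHom Z Y, sval v =1 g \o w -> f = g}.
  by apply: cid; case: v => v [sv vc]; exact: wU.
exists (fun v => sval (ex v)) => [f|v].
  by apply: (svalP (ex (pullback f p))).2.
have [+ _] := svalP (ex v); move: (sval (ex v)) => f; case: v => v vP vf.
by apply: eq_exist; apply/funext=> a; rewrite [RHS]vf.
Qed.

End Tropicalization.

Theorem theorem4 (k : fieldType) (S : comPzSemiRingType)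
    (S_idem : idempotent_op (@GRing.add S))
    (nu : k -> S) (nu_semival : semivaluation nu)
    (A : comAlgType k) (A_integral : GRing.integral_domain_axiom A) :
  represents (Trop_univ nu A) (Semivaluations nu A) /\
  exists w : A -> regular (Trop_univ nu A), universal nu w.
Proof.
have wU := univ_semival_universal nu_semival S_idem A_integral.
split; last by exists (univ_semival nu (A := A)).
exact: universal_represents wU.
Qed.
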